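(* There exists an absolute constant $\eta>0$ such that for all sufficiently large $n$, $(1/2-\eta)n\ge F^{\mathrm{weak}}(n)\ge F_2(n)$.
   Context: For a positive integer $n$, $[n]=\{1,\dots,n\}$ and $[n]^{(2)}$ is the set of $2$-element subsets of $[n]$. $\mathcal{C}_{n;r}$ is the set of all maps $c:[n]^{(2)}\to[r]$. For such $c$, a twin of size $\ell$ is a pair of disjoint sets $I=\{i_1<\dots<i_\ell\}$, $J=\{j_1<\dots<j_\ell\}\subset[n]$ with $c(\{i_t,i_{t+1}\})=c(\{j_t,j_{t+1}\})$ for all $t=1,\dots,\ell-1$; $f(c)$ is the maximum size of a twin of $c$, and $F_r(n)=\min_{c\in\mathcal{C}_{n;r}}f(c)$. For $\pi\in S_n$, a weak-twin of $\pi$ is a pair of disjoint sets $I=\{i_1<\dots<i_\ell\}$, $J=\{j_1<\dots<j_\ell\}\subset[n]$ such that for each $t\in[\ell-1]$, $\pi(i_t)<\pi(i_{t+1})$ if and only if $\pi(j_t)<\pi(j_{t+1})$; $f^{\mathrm{weak}}(\pi)$ is the largest $\ell$ such that $\pi$ has a weak-twin with $|I|=\ell$, and $F^{\mathrm{weak}}(n)=\min_{\pi\in S_n}f^{\mathrm{weak}}(\pi)$. *)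

(* Defs.v *)
From mathcomp Require Import all_boot all_order all_fingroup all_algebra.
From mathcomp Require Import reals.

Set Implicit Arguments.
Unset Strict Implicit.
Unset Printing Implicit Defensive.

(* The vertex set [n] is 'I_n, i.e. shifted to {0, ..., n-1}; only its order
   matters. *)
Notation pairs n := {e : {set 'I_n} | #|e| == 2}.

Notation coloring n r := {ffun pairs n -> 'I_r}.

(* [Some] of the colour of {i, j} when i != j; it is [None] only when i = j,
   which does not occur below. *)
Definition color (n r : nat) (c : coloring n r) (i j : 'I_n) : option 'I_r :=
  omap c (insub [set i; j]).

(* The t-th smallest element of A, counting from 0: [enum] lists a set of
   ordinals increasingly.  The default x0 is irrelevant when t < #|A|. *)
Definition elt (n : nat) (A : {set 'I_n}) (x0 : 'I_n) (t : nat) : 'I_n :=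
  nth x0 (enum A) t.

Definition is_twin (n r : nat) (c : coloring n r) (I J : {set 'I_n}) : bool :=
  [&& [disjoint I & J], #|I| == #|J| &
   [forall x0 : 'I_n, forall t : 'I_(#|I|.-1),
      color c (elt I x0 t) (elt I x0 t.+1)
        == color c (elt J x0 t) (elt J x0 t.+1)]].

Definition f (n r : nat) (c : coloring n r) : nat :=
  \max_(p : {set 'I_n} * {set 'I_n} | is_twin c p.1 p.2) #|p.1|.

(* Since f c <= n for every c, the initial value n does not affect the minimum
   as soon as there is a colouring (e.g. for r > 0). *)
Definition F (r n : nat) : nat := \big[minn/n]_(c : coloring n r) f c.

Definition is_weak_twin (n : nat) (s : 'S_n) (I J : {set 'I_n}) : bool :=
  [&& [disjoint I & J], #|I| == #|J| &
   [forall x0 : 'I_n, forall t : 'I_(#|I|.-1),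
      (s (elt I x0 t) < s (elt I x0 t.+1))
        == (s (elt J x0 t) < s (elt J x0 t.+1))]].

Definition fweak (n : nat) (s : 'S_n) : nat :=
  \max_(p : {set 'I_n} * {set 'I_n} | is_weak_twin s p.1 p.2) #|p.1|.

Definition Fweak (n : nat) : nat := \big[minn/n]_(s : 'S_n) fweak s.

(* Main.v *)
(* Upper bound.  Take a layered permutation: increasing on consecutive blocks of
   odd sizes s_1, s_2, ..., decreasing from one block to the next.  If I and J
   meet the k-th block in a_k and b_k points, then (I, J) is a weak twin iff the
   sequences (a_k) and (b_k) coincide once their zeros are deleted.  Scan the
   blocks from left to right and keep, first in first out, the nonzero parts of
   the set that is ahead which the other set has not matched yet.  A block of
   size s may pop a part x and push a part y with x + y <= s; when the queue is
   empty it may also be shared evenly, which wastes a point since s is odd.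
   Give a state with w wasted points and queue Q the weight 100^-w times the
   product over x in Q of a suitable g(x).  For s uniform among the odd numbers
   below 4M, the expected total weight of the successors of a state is at most
   24/25 of its weight.  Hence some choice of block sizes makes the weights of
   all reachable states exponentially small, and every weak twin of the
   corresponding permutation wastes linearly many points.

   Lower bound.  Colour {i < j} according to whether pi(i) < pi(j). *)
Require Import Defs.
From mathcomp Require Import all_boot all_order all_fingroup all_algebra.
From mathcomp Require Import reals zify ring lra.
Import Order.TTheory GRing.Theory Num.Theory.

Set Implicit Arguments.
Unset Strict Implicit.
Unset Printing Implicit Defensive.

(** * Twins as runs of a queue *)

Definition push (y : nat) : seq nat := nseq (0 < y)%N y.

(* Successors of the state (w, Q), with w wasted points and queue Q, when a
   block of size s is read.  Which of I and J is ahead need not be recorded,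
   since the transitions are the same in both cases. *)
Definition step (s : nat) (c : nat * seq nat) : seq (nat * seq nat) :=
  let: (w, Q) := c in
  [seq ((w + (s - y))%N, Q ++ push y) | y <- iota 0 s.+1] ++
  match Q with
  | [::] => [seq ((w + (s - y.*2))%N, [::]) | y <- iota 1 s./2]
  | x :: Q' =>
    if (x <= s)%N
    then [seq ((w + (s - x - y))%N, Q' ++ push y) | y <- iota 0 (s - x).+1]
    else [::]
  end.

Definition stepL (C : seq (nat * seq nat)) (s : nat) := flatten [seq step s c | c <- C].

Definition nonzero (a : seq nat) := [seq x <- a | 0 < x].

Lemma push_nonzero y a : nonzero (y :: a) = push y ++ nonzero a.
Proof. by rewrite /nonzero /push /=; case: y. Qed.

Lemma stepL_mem C s c d : c \in C -> d \in step s c -> d \in stepL C s.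
Proof. by move=> cC dc; apply/flattenP; exists (step s c); rewrite ?map_f. Qed.

Lemma step_push s w Q y : y <= s -> ((w + (s - y))%N, Q ++ push y) \in step s (w, Q).
Proof.
move=> ys; rewrite mem_cat; apply/orP; left.
by apply/mapP; exists y; rewrite // mem_iota; lia.
Qed.

Lemma step_pop s w x Q y : x + y <= s ->
  (w + (s - x - y), Q ++ push y) \in step s (w, x :: Q).
Proof.
move=> xys; rewrite mem_cat; apply/orP; right.
have -> : x <= s by lia.
by apply/mapP; exists y; rewrite // mem_iota; lia.
Qed.

Lemma step_both s w y : 0 < y -> y.*2 <= s ->
  (w + (s - y.*2), [::]) \in step s (w, [::]).
Proof.
move=> y0 ys; rewrite mem_cat; apply/orP; right.
by apply/mapP; exists y; rewrite // mem_iota; lia.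
Qed.

(** Induction over the blocks. The invariant [Q ++ nonzero a = nonzero b] says that [a] is ahead and
    [Q] lists its parts not yet matched by [b]. *)
Lemma composition_run ss :
  forall (a b : seq nat) (w : nat) (Q : seq nat) (C : seq (nat * seq nat)),
  size a = size ss -> size b = size ss ->
  (forall k, nth 0 a k + nth 0 b k <= nth 0 ss k) ->
  Q ++ nonzero a = nonzero b -> (w, Q) \in C ->
  exists2 w', (w', [::]) \in foldl stepL C ss &
    w' + (sumn a + sumn b) = w + sumn ss.
Proof.
elim: ss => [|s ss IH] [|x a] [|y b] w Q C //.
  by rewrite /= cats0 => _ _ _ -> wC; exists w.
move=> [sza] [szb] le.
have le0 := le 0; have leS k := le k.+1; rewrite /= in le0 leS.
have leS' k : nth 0 b k + nth 0 a k <= nth 0 ss k by rewrite addnC.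
rewrite !push_nonzero; case: y le0 le => [|y] le0 le.
  rewrite /push /= catA => eQ wC.
  have xs : x <= s by lia.
  have := stepL_mem wC (step_push w Q xs).
  by case/(IH a b) => // w' w'C e; exists w' => //=; lia.
case: Q => [|q Q]; last first.
  case=> -> eQ wC.
  have xs : y.+1 + x <= s by lia.
  have := stepL_mem wC (step_pop w Q xs).
  case/(IH a b) => //; first by rewrite -catA.
  by move=> w' w'C e; exists w' => //=; lia.
(* The queue is empty and [b] has a part here. If [a] has none, [b] takes the lead and the roles
   swap; otherwise the two parts are equal. *)
case: x le0 le => [|x] le0 le /=.
  move=> eQ wC.
  have ys : y.+1 <= s by lia.
  have := stepL_mem wC (step_push w [::] ys).
  case/(IH b a) => //.
  by move=> w' w'C e; exists w' => //=; lia.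
case=> exy eQ wC; rewrite exy in le0 le *.
have ys : y.+1.*2 <= s by lia.
have := stepL_mem wC (step_both w (ltn0Sn y) ys).
case/(IH a b) => //.
by move=> w' w'C e; exists w' => //=; lia.
Qed.

(** * Lengths of maximal constant runs, and multiplicities *)

Fixpoint runs (u : seq nat) : seq nat :=
  if u is x :: u' then
    if (0 < size u') && (x == head 0 u')
    then (head 0 (runs u')).+1 :: behead (runs u') else 1 :: runs u'
  else [::].

Lemma runs_eq u v : size u = size v ->
  (forall t, t.+1 < size u ->
     (nth 0 u t == nth 0 u t.+1) = (nth 0 v t == nth 0 v t.+1)) ->
  runs u = runs v.
Proof.
elim: u v => [|x u IH] [|y v] //= [szuv] h.
rewrite -(IH v) // => [|t tu]; last by have := h t.+1 tu.
rewrite -szuv; case: ifP => [/andP[u0 xu]|].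
  by have := h 0 u0; rewrite /= !nth0 xu u0 => <-.
case: (ltnP 0 (size u)) => //= u0; have := h 0 u0.
by rewrite /= !nth0 => -> ->.
Qed.

Lemma nonzero_map_eq0 (A : seq nat) (F : nat -> nat) :
  {in A, forall k, F k = 0} -> nonzero [seq F k | k <- A] = [::].
Proof.
elim: A => //= k A IH h; rewrite h ?mem_head //= IH // => j jA.
by apply: h; rewrite in_cons jA orbT.
Qed.

Lemma nonzero_count_split x m K u : m <= x < m + K -> all (leq x) u ->
  nonzero [seq count_mem k u | k <- iota m K] =
  push (count_mem x u) ++ nonzero [seq count_mem k u | k <- iota x.+1 (m + K - x.+1)].
Proof.
move=> xm /allP ux.
have -> : iota m K = iota m (x - m) ++ x :: iota x.+1 (m + K - x.+1).
  have -> : K = (x - m) + (m + K - x.+1).+1 by lia.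
  rewrite iotaD; congr (_ ++ _).
  have -> : m + (x - m) = x by lia.
  by rewrite /=; congr (_ :: iota _ _); lia.
rewrite map_cat /nonzero filter_cat -/(nonzero _) nonzero_map_eq0 /= -/(nonzero _).
  by case: (count_mem x u).
move=> k; rewrite mem_iota => km; apply/count_memPn/negP => /ux.
by lia.
Qed.

(** Equal entries of a sorted sequence are adjacent, so each value that occurs forms one run, whose
    length is its multiplicity. *)
Lemma nonzero_count m K u : sorted leq u -> all (fun x => m <= x < m + K) u ->
  nonzero [seq count_mem k u | k <- iota m K] = runs u.
Proof.
elim: u => [|x u IH] su; first by move=> _; rewrite nonzero_map_eq0.
case/andP => xm um.
have xu : all (leq x) u by rewrite (order_path_min leq_trans su).
have {}IH := IH (path_sorted su) um.
rewrite (nonzero_count_split xm) /= ?leqnn // eqxx add1n.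
have -> : [seq (x == k) + count_mem k u | k <- iota x.+1 (m + K - x.+1)]
   = [seq count_mem k u | k <- iota x.+1 (m + K - x.+1)].
  by apply/eq_in_map => k; rewrite mem_iota => kx; case: eqP => //; lia.
(* Splitting the tail at the same value shows whether [x] extends the first run of [u] or starts a
   new one. *)
rewrite -IH (nonzero_count_split xm xu) /=.
case: ifP => [/andP[u0 /eqP xE]|xnu].
  have : 0 < count_mem x u.
    rewrite -has_count; apply/hasP; exists x => //=.
    by rewrite [X in X \in _]xE -nth0 mem_nth.
  by case: (count_mem x u).
have -> // : count_mem x u = 0.
apply/count_memPn/negP => xinu.
case: u su xu um IH xnu xinu => //= y u /andP[xy su] _ _ _ /negbT xney.
rewrite in_cons (negbTE xney) /= => xinu.
have := order_path_min leq_trans su => /allP/(_ _ xinu) yx.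
by move: xney; rewrite eqn_leq xy yx.
Qed.

Lemma sumn_count K u : all (ltn^~ K) u ->
  sumn [seq count_mem k u | k <- iota 0 K] = size u.
Proof.
move=> uK; rewrite sumnE big_map.
under eq_bigr => k _ do rewrite -sum1_count big_mkcond /=.
rewrite exchange_big /= -sum1_size big_seq [RHS]big_seq.
apply: eq_bigr => x /(allP uK) xK.
rewrite (bigD1_seq x) ?iota_uniq ?mem_iota //= eqxx big1 // => k.
by rewrite eq_sym => /negbTE ->.
Qed.

(** * Layered permutations *)

Definition layout (bs : seq nat) : seq nat :=
  flatten [seq nseq (nth 0 bs k) k | k <- iota 0 (size bs)].

Lemma size_layout bs : size (layout bs) = sumn bs.
Proof.
rewrite /layout size_flatten /shape -map_comp.
rewrite (eq_map (g := nth 0 bs)) => [|k]; last by rewrite /= size_nseq.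
by rewrite map_nth_iota0 // take_size.
Qed.

Lemma count_layout bs k : k < size bs -> count_mem k (layout bs) = nth 0 bs k.
Proof.
move=> kb; rewrite /layout count_flatten -map_comp sumnE big_map.
rewrite (bigD1_seq k) ?iota_uniq ?mem_iota //=.
rewrite count_nseq /= eqxx mul1n big1 ?addn0 // => j jk.
by rewrite count_nseq /= (negbTE jk).
Qed.

Lemma layout_lt bs : all (ltn^~ (size bs)) (layout bs).
Proof.
apply/allP => x /flattenP[s /mapP[k]]; rewrite mem_iota => kb -> /nseqP[-> _].
by case/andP: kb.
Qed.

Lemma layout_sorted bs : sorted leq (layout bs).
Proof.
have h m K : sorted leq (flatten [seq nseq (nth 0 bs k) k | k <- iota m K]).
  elim: K m => //= K IH m.
  rewrite (sorted_pairwise leq_trans) pairwise_cat -!(sorted_pairwise leq_trans).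
  rewrite IH andbT; apply/andP; split; last first.
    elim: (nth 0 bs m) => //= r.
    by rewrite (path_sortedE leq_trans) => ->; rewrite all_nseq leqnn orbT.
  apply/allrelP => x y /nseqP[-> _] /flattenP[s /mapP[k]].
  by rewrite mem_iota => km -> /nseqP[-> _]; lia.
exact: h.
Qed.

(** Take for [s i] the number of indices with a smaller key. *)
Lemma exists_perm_rank n (key : 'I_n -> nat) : injective key ->
  exists s : 'S_n, forall i j, (s i < s j) = (key i < key j).
Proof.
move=> key_inj; pose below i := [set j | key j < key i].
have below_lt i : #|below i| < n.
  rewrite -[n in _ < n]card_ord -cardsT proper_card // properT.
  by apply/negP => /eqP/setP/(_ i); rewrite !inE ltnn.
have below_mono i j : key i < key j -> #|below i| < #|below j|.
  move=> ij; apply/proper_card/properP; split.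
    by apply/subsetP => k; rewrite !inE => ki; apply: ltn_trans ki ij.
  by exists i; rewrite !inE ?ij ?ltnn.
pose r i := Ordinal (below_lt i).
have r_inj : injective r.
  move=> i j /(congr1 val) /= eij; apply: key_inj.
  by case: (ltngtP (key i) (key j)) => // /below_mono; rewrite eij ltnn.
exists (perm r_inj) => i j; rewrite !permE /=; apply/idP/idP; last exact: below_mono.
move=> rij; rewrite ltnNge leq_eqVlt; apply/negP => /orP[/eqP/key_inj eij|/below_mono].
  by rewrite eij ltnn in rij.
by rewrite ltnNge ltnW.
Qed.

Lemma exists_layered n (bs : seq nat) : sumn bs = n ->
  exists s : 'S_n, forall i j : 'I_n, i < j ->
    (s i < s j) = (nth 0 (layout bs) i == nth 0 (layout bs) j).
Proof.
move=> bsn; pose z := nth 0 (layout bs).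
have z_lt (i : 'I_n) : z i < size bs.
  by apply: (allP (layout_lt bs)); rewrite mem_nth // size_layout bsn.
(* Lexicographic key: blocks in reverse order, then positions. As [i < n], the position is the
   remainder modulo [n]. *)
pose key (i : 'I_n) := (size bs - z i) * n + i.
have key_inj : injective key.
  move=> i j e; apply: val_inj; have := congr1 (modn^~ n) e.
  by rewrite /key /= !modnMDl !modn_small.
have [s sE] := exists_perm_rank key_inj; exists s => i j ij; rewrite sE /key.
have : z i <= z j.
  apply: (sorted_leq_nth leq_trans leqnn 0 (layout_sorted bs));
    rewrite ?inE ?size_layout ?bsn //.
  exact: ltnW.
rewrite -/(z i) -/(z j) leq_eqVlt => /orP[/eqP ->|zij].
  by rewrite eqxx ltn_add2l.
rewrite ltn_eqF //; apply/negbTE; rewrite -leqNgt.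
have -> : size bs - z i = (size bs - z j) + (z j - z i).-1.+1 by have := z_lt j; lia.
rewrite mulnDl mulSn -!addnA leq_add2l.
exact: leq_trans (ltnW (ltn_ord j)) (leq_addr _ _).
Qed.

Lemma elt_ltn n (A : {set 'I_n}) x0 t : (t.+1 < #|A|) -> (elt A x0 t < elt A x0 t.+1).
Proof.
move=> tA.
have srt : sorted ltn (map val (enum A)).
  apply: (subseq_sorted ltn_trans _ (iota_ltn_sorted 0 n)).
  rewrite -val_enum_ord; apply: map_subseq.
  by rewrite {1}/enum_mem -enumT filter_subseq.
have := sorted_ltn_nth ltn_trans 0 srt.
move/(_ t t.+1); rewrite !inE size_map -cardE => /(_ (ltnW tA) tA (ltnSn t)).
by rewrite !(nth_map x0) -?cardE // ltnW.
Qed.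

(** * Weak twins of a layered permutation *)

Section Blocks.
Variables (n : nat) (bs : seq nat).
Hypothesis bs_sum : sumn bs = n.

Definition labels (I : {set 'I_n}) : seq nat :=
  [seq nth 0 (layout bs) (val i) | i <- enum I].

Lemma labels_subseq I : subseq (labels I) (layout bs).
Proof.
have -> : layout bs = [seq nth 0 (layout bs) i | i <- map val (enum 'I_n)].
  by rewrite val_enum_ord map_nth_iota0 -bs_sum -size_layout ?take_size.
rewrite -map_comp; apply: map_subseq.
by rewrite {1}/enum_mem -enumT filter_subseq.
Qed.

Lemma size_labels I : size (labels I) = #|I|.
Proof. by rewrite size_map cardE. Qed.

Lemma labels_lt I : all (ltn^~ (size bs)) (labels I).
Proof.
apply/allP => x xI; apply: (allP (layout_lt bs)).
exact: mem_subseq (labels_subseq I) _ xI.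
Qed.

Lemma labels_sorted I : sorted leq (labels I).
Proof. exact: subseq_sorted leq_trans _ _ (labels_subseq I) (layout_sorted bs). Qed.

Lemma count_labels (I J : {set 'I_n}) k : [disjoint I & J] -> k < size bs ->
  count_mem k (labels I) + count_mem k (labels J) <= nth 0 bs k.
Proof.
move=> IJ kb; rewrite -count_layout //.
have cE (A : {set 'I_n}) :
    count_mem k (labels A) = \sum_(i in A) (nth 0 (layout bs) i == k).
  rewrite /labels count_map -sum1_count big_mkcond big_enum /=.
  by apply: eq_bigr => i _ /=; case: eqP.
have -> : count_mem k (layout bs) = count_mem k (labels setT).
  rewrite /labels enum_setT -enumT (map_comp (nth 0 (layout bs)) val).
  by rewrite val_enum_ord map_nth_iota0 -bs_sum -size_layout ?take_size.
rewrite !cE -bigU //= [X in _ <= X](bigID (mem (I :|: J))) /=.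
apply: leq_trans (leq_addr _ _); apply: eq_leq.
by apply: eq_bigl => i; rewrite !inE.
Qed.

(** Two positions form an ascent exactly when they share a block, so the labels of [I] and [J] have
    the same run lengths. Their multiplicities are the sequences fed to [composition_run]. *)
Lemma weak_twin_run (s : 'S_n) :
  (forall i j : 'I_n, i < j ->
    (s i < s j) = (nth 0 (layout bs) i == nth 0 (layout bs) j)) ->
  forall I J, is_weak_twin s I J ->
  exists2 w, (w, [::]) \in foldl stepL [:: (0, [::])] bs & w + #|I|.*2 = n.
Proof.
move=> sE I J /and3P[IJ /eqP cIJ /forallP tw].
pose cnt A := [seq count_mem k (labels A) | k <- iota 0 (size bs)].
have szc A : size (cnt A) = size bs by rewrite size_map size_iota.
have nzc A : nonzero (cnt A) = runs (labels A).
  by rewrite nonzero_count ?labels_sorted // labels_lt.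
have eltE (A : {set 'I_n}) (x0 : 'I_n) t : t < #|A| ->
    nth 0 (labels A) t = nth 0 (layout bs) (elt A x0 t).
  by move=> tA; rewrite (nth_map x0) // -cardE.
have eq_runs : runs (labels I) = runs (labels J).
  apply: runs_eq; rewrite !size_labels // => t tI.
  have [x0 _] : exists x0, x0 \in I by apply/card_gt0P; lia.
  have tJ : t.+1 < #|J| by rewrite -cIJ.
  have t1 : t < #|I|.-1 by lia.
  have /forallP/(_ (Ordinal t1))/eqP /= := tw x0.
  rewrite !(eltE _ x0) ?(ltnW tI) ?(ltnW tJ) //.
  by rewrite !sE // elt_ltn.
have [|||||w wC wE] := @composition_run bs (cnt I) (cnt J) 0 [::] [:: (0, [::])].
- exact: szc.
- exact: szc.
- move=> k; case: (ltnP k (size bs)) => kb; last by rewrite !nth_default ?szc.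
  by rewrite !(nth_map 0) ?size_iota // !nth_iota // count_labels.
- by rewrite /= !nzc eq_runs.
- by rewrite mem_head.
exists w => //; move: wE.
by rewrite !sumn_count ?labels_lt // !size_labels bs_sum -cIJ; lia.
Qed.
End Blocks.

(** * Exponential decay of the potential *)

Local Open Scope ring_scope.

Section Potential.
Variables (R : realFieldType) (M : nat).
Hypothesis M_large : (300 <= M)%N.
Definition tau : R := 1 / 100.

(* Parts longer than half of the maximal block size 4M are given a smaller
   weight, because fewer blocks can match them. *)
Definition weight (x : nat) : R := if (x <= M.*2)%N then 1 / 20 else 1 / 30.
Definition queue_weight (Q : seq nat) : R := \prod_(x <- Q) weight x.
Definition potential (C : seq (nat * seq nat)) : R :=
  \sum_(c <- C) tau ^+ c.1 * queue_weight c.2.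

Lemma weight_gt0 x : 0 < weight x.
Proof. by rewrite /weight; case: ifP => _; lra. Qed.

Lemma weight_ge x : 1 / 30 <= weight x.
Proof. by rewrite /weight; case: ifP => _; lra. Qed.

Lemma queue_weight_gt0 Q : 0 < queue_weight Q.
Proof. by apply: prodr_gt0 => x _; apply: weight_gt0. Qed.

Lemma queue_weight_cat Q1 Q2 :
  queue_weight (Q1 ++ Q2) = queue_weight Q1 * queue_weight Q2.
Proof. exact: big_cat. Qed.

Lemma queue_weight_push y : queue_weight (push y) = if y == 0%N then 1 else weight y.
Proof. by case: y => [|y]; rewrite /queue_weight /push ?big_nil ?big_seq1. Qed.

Lemma potential_cat C D : potential (C ++ D) = potential C + potential D.
Proof. exact: big_cat. Qed.

Lemma sum_tau m : \sum_(u < m) tau ^+ u <= 100 / 99.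
Proof.
have h : \sum_(u < m) tau ^+ u = (1 - tau ^+ m) * (100 / 99).
  elim: m => [|m IH]; first by rewrite big_ord0 expr0 subrr mul0r.
  by rewrite big_ord_recr /= IH exprS /tau; field.
have h2 : 0 <= tau ^+ m by apply: exprn_ge0; rewrite /tau; lra.
by rewrite h; move: (tau ^+ m) h2 => t; lra.
Qed.

Lemma sum_interval m a b : (\sum_(i < m) (a <= i < b) <= b - a)%N.
Proof.
suff: (\sum_(i < m) (a <= i < b) <= minn m b - a)%N by lia.
elim: m => [|m IH]; first by rewrite big_ord0.
rewrite big_ord_recr /=; move: (\sum_(i < m) _)%N IH => S.
by case: (boolP (a <= m < b)%N) => /=; lia.
Qed.

Definition itv_ind (a b i : nat) : R := (a <= i < b)%N%:R.

Lemma itv_ind_ge0 a b i : 0 <= itv_ind a b i.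
Proof. exact: ler0n. Qed.

Lemma itv_ind1 a b i : (a <= i < b)%N -> itv_ind a b i = 1.
Proof. by rewrite /itv_ind => ->. Qed.

Lemma sum_itv_ind m a b : \sum_(i < m) itv_ind a b i <= (b - a)%N%:R.
Proof. by rewrite -natr_sum ler_nat sum_interval. Qed.

(** The empty part occurs for at most one [i] and contributes 1. If [x <= 2M], at most M indices
    give short parts and at most M give long ones: M/20 + M/30 = M/12. If [x > 2M], only indices
    [i >= M] remain: M/20. *)
Lemma sum_push_weight x :
  \sum_(i < M.*2 | (x <= i.*2.+1)%N) queue_weight (push (i.*2.+1 - x)) <=
  1 + (if (x <= M.*2)%N then 1 / 12 else 1 / 20) * M%:R.
Proof.
(* The least [i] with [x < 2i + 1]. *)
pose h := (x.+1)./2.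
have i1 := sum_itv_ind M.*2 x./2 x./2.+1.
have i2 := sum_itv_ind M.*2 h (h + M).
have i3 := sum_itv_ind M.*2 (h + M) M.*2.
have i4 := sum_itv_ind M.*2 M M.*2.
have e1 : (x./2.+1 - x./2 = 1)%N by lia.
have e2 : (h + M - h = M)%N by lia.
have e4 : (M.*2 - M = M)%N by lia.
have e3 : (M.*2 - (h + M))%N%:R <= M%:R :> R by rewrite ler_nat; lia.
rewrite e1 in i1; rewrite e2 in i2; rewrite e4 in i4.
have g0 (i : 'I_M.*2) : 0 <= itv_ind x./2 x./2.+1 i by exact: itv_ind_ge0.
rewrite big_mkcond.
case: ifP => xM.
- apply: (@le_trans _ _ (\sum_(i < M.*2) (itv_ind x./2 x./2.+1 i
     + 1 / 20 * itv_ind h (h + M) i + 1 / 30 * itv_ind (h + M) M.*2 i))).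
    apply: ler_sum => i _.
    have g1 := g0 i.
    have g2 := itv_ind_ge0 h (h + M) i.
    have g3 := itv_ind_ge0 (h + M) M.*2 i.
    have lti := ltn_ord i.
    case: ifP => xi; last by lra.
    rewrite queue_weight_push; case: eqP => ix; first by rewrite itv_ind1; [lra | lia].
    rewrite /weight; case: ifP => iM.
      by rewrite (@itv_ind1 h (h + M)); [lra | lia].
    by rewrite (@itv_ind1 (h + M) M.*2); [lra | lia].
  rewrite !big_split /= -!mulr_sumr; lra.
apply: (@le_trans _ _ (\sum_(i < M.*2) (itv_ind x./2 x./2.+1 i
   + 1 / 20 * itv_ind M M.*2 i))).
  apply: ler_sum => i _.
  have g1 := g0 i.
  have g2 := itv_ind_ge0 M M.*2 i.
  have lti := ltn_ord i.
  case: ifP => xi; last by lra.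
  rewrite queue_weight_push; case: eqP => ix; first by rewrite itv_ind1; [lra | lia].
  rewrite (@itv_ind1 M M.*2); last by lia.
  by rewrite /weight; case: ifP => _; lra.
rewrite !big_split /= -!mulr_sumr; lra.
Qed.

(** Sort by the waste u: wasting u points after using [x] amounts to using [x + u] and wasting none.
    The bound of [sum_push_weight] does not increase with [x], so a geometric series in [tau]
    remains. *)
Lemma sum_successor_weight x :
  \sum_(i < M.*2 | (x <= i.*2.+1)%N) \sum_(y < (i.*2.+1 - x).+1)
     tau ^+ (i.*2.+1 - x - y) * queue_weight (push y) <=
  100 / 99 * (1 + (if (x <= M.*2)%N then 1 / 12 else 1 / 20) * M%:R).
Proof.
set B := (X in 100 / 99 * X).
have B_ge0 : 0 <= B by rewrite /B addr_ge0 // mulr_ge0 //; case: ifP => _; lra.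
have tau_ge0 : 0 <= tau by rewrite /tau; lra.
apply: (@le_trans _ _ (\sum_(u < M.*2.*2) tau ^+ u * B)); last first.
  by rewrite -mulr_suml ler_wpM2r // sum_tau.
apply: (@le_trans _ _ (\sum_(u < M.*2.*2) tau ^+ u *
   \sum_(i < M.*2 | (x + u <= i.*2.+1)%N)
     queue_weight (push (i.*2.+1 - (x + u))))); last first.
  apply: ler_sum => u _; apply: ler_wpM2l; first exact: exprn_ge0.
  apply: le_trans (sum_push_weight _) _; rewrite /B lerD2l ler_wpM2r ?ler0n //.
  by case: ifP => h1; case: ifP => h2; try lra; lia.
under [X in _ <= X]eq_bigr => u _ do rewrite mulr_sumr big_mkcond.
rewrite exchange_big /= [X in X <= _]big_mkcond; apply: ler_sum => i _.
have lti := ltn_ord i.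
case: ifP => xi; last first.
  rewrite sumr_ge0 // => u _; case: ifP => // _.
  by rewrite mulr_ge0 ?exprn_ge0 // ltW // queue_weight_gt0.
(* Reversal replaces [y] by the waste [2i + 1 - x - y]. *)
rewrite (reindex_inj rev_ord_inj) /=.
rewrite -big_mkcond.
have le : ((i.*2.+1 - x).+1 <= M.*2.*2)%N by lia.
rewrite (big_ord_widen _ (fun u => tau ^+ (i.*2.+1 - x - ((i.*2.+1 - x).+1 - u.+1)) *
   queue_weight (push ((i.*2.+1 - x).+1 - u.+1))) le).
rewrite le_eqVlt; apply/orP; left; apply/eqP; apply: eq_big => [u|u ux]; first by lia.
by congr (tau ^+ _ * queue_weight (push _)); lia.
Qed.

(** Popping [x] divides the weight by [weight x]. Up to the factor 100/99 and constant terms, a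
    nonempty queue gives M/12 + 20 M/12 if its head is short and M/12 + 30 M/20 if it is long, both
    below 24/25 * 2M. *)
Lemma potential_step c :
  \sum_(i < M.*2) potential (step i.*2.+1 c) <=
  24 / 25 * M.*2%:R * potential [:: c].
Proof.
case: c => w Q.
(* This size of M absorbs the constant terms in the closing linear inequalities. *)
have MR : 300%N%:R <= M%:R :> R by rewrite ler_nat.
have M2 : M.*2%:R = 2 * M%:R :> R by rewrite -muln2 natrM mulrC.
have tw : 0 < tau ^+ w by rewrite exprn_gt0 // /tau; lra.
(* One formula for both kinds of successors: not popping is the case [x = 0], [Q' = Q]. *)
have partE s x Q' : (x <= s)%N ->
  potential [seq ((w + (s - x - y))%N, Q' ++ push y) | y <- iota 0 (s - x).+1]
   = tau ^+ w * queue_weight Q' *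
     \sum_(y < (s - x).+1) tau ^+ (s - x - y) * queue_weight (push y).
  move=> xs; rewrite /potential big_map mulr_sumr -/(index_iota 0 (s - x).+1).
  rewrite big_mkord; apply: eq_bigr => y _ /=.
  by rewrite queue_weight_cat exprD; ring.
have sum_part0 : \sum_(i < M.*2) potential
   [seq ((w + (i.*2.+1 - y))%N, Q ++ push y) | y <- iota 0 i.*2.+2]
   <= tau ^+ w * queue_weight Q * (100 / 99 * (1 + 1 / 12 * M%:R)).
  under eq_bigr => i _ do rewrite -{1 2}[i.*2.+1]subn0 partE //.
  rewrite -mulr_sumr ler_wpM2l ?mulr_ge0 //; [exact: ltW|exact/ltW/queue_weight_gt0|].
  have := sum_successor_weight 0; rewrite leq0n.
  under eq_bigl => i do rewrite leq0n.
  by [].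
rewrite /step.
under eq_bigr => i _ do rewrite potential_cat.
rewrite big_split /=.
have -> : potential [:: (w, Q)] = tau ^+ w * queue_weight Q.
  by rewrite /potential big_seq1.
have GQ := queue_weight_gt0 Q.
case: Q sum_part0 GQ => [|x Q] sum_part0 GQ.
  have part2 (i : 'I_M.*2) :
    potential [seq ((w + (i.*2.+1 - y.*2))%N, [::]) | y <- iota 1 (uphalf i.*2)]
    <= tau ^+ w * (1 / 10).
    rewrite uphalf_double /potential big_map -[iota 1 i]/(iota (1 + 0) i).
    rewrite iotaDl big_map -[i in iota 0 i]subn0 -/(index_iota 0 i) big_mkord.
    under eq_bigr => y _ do rewrite /= /queue_weight big_nil mulr1 exprD.
    rewrite -mulr_sumr ler_wpM2l ?(ltW tw) //.
    rewrite (reindex_inj rev_ord_inj) /=.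
    apply: (@le_trans _ _ (\sum_(u < i) tau * tau ^+ u)); last first.
      by rewrite -mulr_sumr; have := sum_tau i; rewrite /tau; lra.
    (* After reversal the waste is [2u + 1], at least [u + 1]; the block being odd keeps it
       positive. *)
    apply: ler_sum => u _; rewrite -exprS.
    have := ltn_ord u => ui.
    apply: ler_wiXn2l; rewrite /tau; try lra.
    by lia.
  apply: le_trans (lerD sum_part0 (ler_sum _ (fun i _ => part2 i))) _.
  rewrite sumr_const card_ord -[_ *+ _]mulr_natr M2.
  rewrite /queue_weight big_nil; nra.
have part2 : \sum_(i < M.*2) potential (if (x <= i.*2.+1)%N then
     [seq ((w + (i.*2.+1 - x - y))%N, Q ++ push y)
         | y <- iota 0 (i.*2.+1 - x).+1] else [::]) <=
     tau ^+ w * queue_weight Q *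
     (100 / 99 * (1 + (if (x <= M.*2)%N then 1 / 12 else 1 / 20) * M%:R)).
  apply: (@le_trans _ _ (\sum_(i < M.*2 | (x <= i.*2.+1)%N) tau ^+ w * queue_weight Q *
     \sum_(y < (i.*2.+1 - x).+1) tau ^+ (i.*2.+1 - x - y) * queue_weight (push y))).
    rewrite [X in _ <= X]big_mkcond; apply: ler_sum => i _; case: ifP => xi.
      by rewrite partE.
    by rewrite /potential big_nil.
  rewrite -mulr_sumr ler_wpM2l ?sum_successor_weight //.
  by rewrite mulr_ge0 // ltW // queue_weight_gt0.
apply: le_trans (lerD sum_part0 part2) _.
have GQ' := queue_weight_gt0 Q.
have -> : queue_weight (x :: Q) = weight x * queue_weight Q.
  by rewrite /queue_weight big_cons.
rewrite M2 /weight.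
have P_gt0 : 0 < tau ^+ w * queue_weight Q by rewrite mulr_gt0.
set m := M%:R in MR *; case: ifP => _.
- rewrite [X in X <= _](_ : _ = tau ^+ w * queue_weight Q *
    (1 / 20 * (100 / 99 * (1 + 1 / 12 * m)) + 100 / 99 * (1 + 1 / 12 * m))); last by ring.
  rewrite [X in _ <= X](_ : _ = tau ^+ w * queue_weight Q *
    (24 / 25 * (2 * m) * (1 / 20))); last by ring.
  by rewrite ler_pM2l //; lra.
rewrite [X in X <= _](_ : _ = tau ^+ w * queue_weight Q *
  (1 / 30 * (100 / 99 * (1 + 1 / 12 * m)) + 100 / 99 * (1 + 1 / 20 * m))); last by ring.
rewrite [X in _ <= X](_ : _ = tau ^+ w * queue_weight Q *
  (24 / 25 * (2 * m) * (1 / 30))); last by ring.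
by rewrite ler_pM2l //; lra.
Qed.

(** Greedy choice: the potential is additive over states, so at each stage some odd size does no
    worse than the average in [potential_step]. *)
Lemma exists_blocks K : exists ss : seq nat,
  [/\ size ss = K, all (fun s => s < M.*2.*2)%N ss &
  potential (foldl stepL [:: (0%N, [::])] ss) <= (24 / 25) ^+ K].
Proof.
elim: K => [|K [ss [szs alls pots]]].
  exists [::]; split=> //=.
  by rewrite /potential big_seq1 /queue_weight big_nil !expr0 mulr1.
set C := foldl _ _ ss in pots.
have [i hi] : exists i : 'I_M.*2, potential (stepL C i.*2.+1) <= 24 / 25 * potential C.
  apply/existsP; apply: contraT; rewrite negb_exists => /forallP h.
  have : \sum_(i < M.*2) potential (stepL C i.*2.+1) <= 24 / 25 * M.*2%:R * potential C.
    have -> : potential C = \sum_(c <- C) potential [:: c].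
      by apply: eq_bigr => c _; rewrite /potential big_seq1.
    rewrite mulr_sumr.
    under eq_bigr => i _ do rewrite /stepL /potential big_flatten big_map /=.
    by rewrite exchange_big /=; apply: ler_sum => c _; apply: potential_step.
  rewrite leNgt => /negP [].
  have -> : 24 / 25 * M.*2%:R * potential C = \sum_(i < M.*2) 24 / 25 * potential C.
    by rewrite sumr_const card_ord -[RHS]mulr_natr mulrAC.
  apply: ltr_sum => [|i _]; last by rewrite ltNge.
  by apply/hasP; exists (Ordinal (ltac:(lia) : (0 < M.*2)%N)); rewrite ?mem_index_enum.
exists (rcons ss i.*2.+1); split.
- by rewrite size_rcons szs.
- by rewrite all_rcons alls andbT /=; have := ltn_ord i; lia.
rewrite foldl_rcons exprS; apply: le_trans hi _.
by rewrite ler_wpM2l //; lra.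
Qed.
End Potential.

(** * The two bounds *)

(** A block pops at most one part and never undoes waste. *)
Lemma step_nil s w0 Q w : (w, [::]) \in step s (w0, Q) ->
  (w0 <= w)%N /\ (size Q <= 1)%N.
Proof.
rewrite mem_cat => /orP[/mapP[y _ [-> e]]|].
  by split; [lia | move/(congr1 size): e; rewrite size_cat /=; lia].
case: Q => [/mapP[y _ [->]]|x Q]; first by split; rewrite ?leq_addr.
case: ifP => // _ /mapP[y _ [-> e]].
by split; [lia | move/(congr1 size): e; rewrite size_cat /=; lia].
Qed.

(** This allows a last block of arbitrary size: the state before it has waste at most [w] and at
    most one queued part, of weight at least 1/30. *)
Lemma pow_le_potential (R : realFieldType) M C s w : (w, [::]) \in stepL C s ->
  tau R ^+ w * (1 / 30) <= potential R M C.
Proof.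
case/flattenP => D /mapP[[w0 Q] cC ->] /step_nil [ww Q1].
have tau_ge0 : 0 <= tau R by rewrite /tau; lra.
apply: (@le_trans _ _ (tau R ^+ w0 * queue_weight R M Q)).
  apply: ler_pM; rewrite ?exprn_ge0 //; first by lra.
    by apply: ler_wiXn2l; rewrite // /tau; lra.
  case: Q Q1 {cC} => [|x [|]] //= _; rewrite /queue_weight ?big_nil ?big_seq1.
    by lra.
  exact: weight_ge.
rewrite /potential (perm_big _ (perm_to_rem cC)) big_cons /= lerDl.
by apply: sumr_ge0 => c _; rewrite mulr_ge0 ?exprn_ge0 // ltW // queue_weight_gt0.
Qed.

(** Bernoulli's inequality for the powers of 25/24 = 1 + 1/24. *)
Lemma bernoulli_pow (R : realFieldType) D : (24 / 25) ^+ D * (1 + D%:R / 24) <= 1 :> R.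
Proof.
elim: D => [|D IH]; first by rewrite expr0; lra.
have p0 : 0 <= (24 / 25) ^+ D :> R by apply: exprn_ge0; lra.
have D0 : 0 <= D%:R :> R by rewrite ler0n.
have DS : D.+1%:R = D%:R + 1 :> R by rewrite natr1.
have pD := mulr_ge0 p0 D0.
by rewrite exprS DS; lra.
Qed.

Lemma exists_small_pow (R : realFieldType) :
  exists2 D, (0 < D)%N & (24 / 25) ^+ D <= tau R.
Proof.
(* Here 1 + 2400/24 = 101 exceeds 1/[tau] = 100. *)
have [D D_large] : exists D, (2400 <= D)%N by exists 2400%N.
exists D; first by lia.
have := bernoulli_pow R D.
have : 2400%:R <= D%:R :> R by rewrite ler_nat.
have : 0 <= (24 / 25) ^+ D :> R by apply: exprn_ge0; lra.
rewrite /tau; move: (_ ^+ _) (D%:R) => p d; nra.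
Qed.

Lemma fweak_linear_waste (R : realFieldType) :
  exists2 P, (0 < P)%N & forall n, exists s : 'S_n,
  forall I J, is_weak_twin s I J ->
  exists2 w, (w + #|I|.*2 = n)%N & (n <= P * (w + 2))%N.
Proof.
have [D D0 smallD] := exists_small_pow R.
have [M M300] : exists M, (300 <= M)%N by exists 300%N.
(* Chosen blocks have fewer than 4M points, and D of them gain a factor [tau]. *)
exists (M.*2.*2 * D)%N => [|n]; first by rewrite muln_gt0 D0 !double_gt0; lia.
set m := M.*2.*2.
have m0 : (0 < m)%N by rewrite /m; lia.
have [ss [szs alls pots]] := exists_blocks R M300 (n %/ m).
have sums : (sumn ss <= n)%N.
  apply: leq_trans (leq_trunc_div n m); rewrite -szs mulnC.
  elim: ss alls {szs pots} => //= x ss IH /andP[xm /IH].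
  by rewrite mulnS -/m in xm *; lia.
(* A last block, of either parity, takes the leftover points. *)
have sumbs : sumn (rcons ss (n - sumn ss)%N) = n by rewrite sumn_rcons; lia.
have [s sE] := exists_layered sumbs; exists s => I J /(weak_twin_run sumbs sE) [w].
rewrite foldl_rcons => /(pow_le_potential R M) wC wn; exists w => //.
have {wC} := le_trans wC pots.
(* With at least D(w+1) chosen blocks the potential would be at most [tau ^+ w] / 100, against the
   lower bound [tau ^+ w] / 30. With fewer blocks, [n] is bounded directly. *)
case: (leqP (D * w.+1) (n %/ m)) => [Dw|nD _]; last first.
  have := ltn_ceil n m0; move: (n %/ m)%N nD => k kD nk.
  rewrite -mulnA; apply: leq_trans (ltnW nk) _; rewrite mulnC leq_mul2l; apply/orP; right.
  by rewrite mulnDr; move: kD; rewrite mulnS; lia.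
have tw : 0 < tau R ^+ w :> R by apply: exprn_gt0; rewrite /tau; lra.
have h1 : (24 / 25) ^+ (n %/ m) <= (24 / 25) ^+ (D * w.+1) :> R.
  by apply: ler_wiXn2l => //; lra.
have h2 : (24 / 25) ^+ (D * w.+1) <= tau R ^+ w.+1 :> R.
  rewrite exprM; apply: lerXn2r => //; rewrite nnegrE; last by rewrite /tau; lra.
  by apply: exprn_ge0; lra.
rewrite exprS {1}/tau in h2 => h3.
by have := le_trans h3 (le_trans h1 h2); lra.
Qed.

Lemma Fweak_le_fweak n (s : 'S_n) : (Fweak n <= fweak s)%N.
Proof. by rewrite /Fweak -leEnat -minEnat; apply: bigmin_le. Qed.

(** * Colourings induced by permutations *)

Lemma color_of_perm n (s : 'S_n) : exists c : coloring n 2,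
  forall i j i' j' : 'I_n, (i < j)%N -> (i' < j')%N ->
    color c i j = color c i' j' -> (s i < s j)%N = (s i' < s j')%N.
Proof.
pose up (e : {set 'I_n}) :=
  [exists i, exists j, [&& i \in e, j \in e, (i < j)%N & (s i < s j)%N]].
pose c : coloring n 2 := [ffun e => if up (val e) then ord_max else ord0].
have upE (i j : 'I_n) : (i < j)%N -> up [set i; j] = (s i < s j)%N.
  move=> ij; apply/existsP/idP => [[i' /existsP[j' /and4P[]]]|sij].
    rewrite !inE => /orP[]/eqP-> /orP[]/eqP->; rewrite ?ltnn //.
    by move=> ji; lia.
  by exists i; apply/existsP; exists j; rewrite !inE !eqxx orbT ij.
have colE (i j : 'I_n) : (i < j)%N ->
    color c i j = Some (if (s i < s j)%N then ord_max else ord0).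
  move=> ij; rewrite /color; case: insubP => [e _ eE|].
    by rewrite /= ffunE eE upE.
  have ne : i != j by apply: contraTneq ij => ->; rewrite ltnn.
  by rewrite cards2 ne.
exists c => i j i' j' ij ij'; rewrite !colE // => -[].
by case: ifP; case: ifP.
Qed.

(** Equal colours mean equal comparisons, so every twin of the induced colouring is a weak twin of
    [s]. *)
Lemma F2_le_Fweak n : (F 2 n <= Fweak n)%N.
Proof.
(* The initial value [n] of the minimum has to be bounded as well. *)
rewrite /Fweak -leEnat -minEnat; apply/bigmin_geP; split.
  by rewrite /F -minEnat; apply: bigmin_le_id.
move=> s _; have [c cE] := color_of_perm s.
apply: (@leq_trans (f c)); first by rewrite /F -leEnat -minEnat; apply: bigmin_le.
apply/bigmax_leqP => -[I J] /= /and3P[IJ cIJ /forallP tw].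
rewrite /fweak (bigD1 (I, J)) ?leq_maxl //=.
apply/and3P; split => //; apply/forallP => x0; apply/forallP => t.
have /forallP/(_ t)/eqP h := tw x0.
have tI : (t.+1 < #|I|)%N by have := ltn_ord t; lia.
by apply/eqP/cE; rewrite ?elt_ltn -?(eqP cIJ).
Qed.

Theorem theorem4 (R : realType) :
  exists eta : R, 0 < eta /\
    exists N : nat, forall n : nat, (N <= n)%N ->
      (1 / 2 - eta) * n%:R >= (Fweak n)%:R :> R /\ (Fweak n >= F 2 n)%N.
Proof.
have [P P0 waste] := fweak_linear_waste R.
have PR : 0 < P%:R :> R by rewrite ltr0n.
(* From [n <= P * (w + 2)] and [4 * P <= n] follows w >= n/(2P); as |I| = (n - w)/2, the loss
   against n/2 is at least n/(4P). *)
exists (1 / (4 * P%:R)); split; first by rewrite divr_gt0 ?mulr_gt0.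
exists (4 * P)%N => n nP; split; last exact: F2_le_Fweak.
have [s sP] := waste n.
suff le_s : (4 * P * fweak s + n <= 2 * P * n)%N.
  have := leq_trans (leq_add (leq_mul (leqnn (4 * P)) (Fweak_le_fweak s)) (leqnn n)) le_s.
  rewrite -(ler_nat R) !(natrD, natrM) => h.
  have -> : (1 / 2 - 1 / (4 * P%:R)) * n%:R = (2 * P%:R * n%:R - n%:R) / (4 * P%:R) :> R.
    by field; rewrite gt_eqF.
  rewrite ler_pdivlMr ?mulr_gt0 //; lra.
have fweak_le : (fweak s <= (2 * P * n - n) %/ (4 * P))%N.
  apply/bigmax_leqP => -[I J] /= /sP [w wE nw].
  rewrite leq_divRL; last by lia.
  have w_ge : (n <= 2 * P * w)%N by nia.
  have : (2 * P * w + #|I| * (4 * P) = 2 * P * n)%N.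
    by rewrite -[in RHS]wE -muln2; ring.
  by move=> <-; rewrite -addnBAC // leq_addl.
have := leq_trans (leq_mul (leqnn (4 * P)) fweak_le).
move/(_ _ (eq_leq (mulnC _ _))) => h.
have {}h := leq_trans h (leq_trunc_div _ _).
have : (n <= 2 * P * n)%N by rewrite leq_pmull // muln_gt0.
by lia.
Qed.
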